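(* Let $X$ be a Banach space which has a shrinking unconditional Schauder basis with unconditional constant less than $2$. Then $\mathcal{B}(X)$ has the uniform ball covering property (UBCP).
   Context: $\mathcal{B}(X)$ is the space of bounded linear operators on $X$ with the operator norm. A normed space $Z$ has the uniform ball covering property (UBCP) if there are points $z_i\in Z$ and radii $r_i>0$ ($i\in\mathbb{N}$) and constants $R,\delta>0$ such that the unit sphere $\{z\in Z:\|z\|=1\}$ is covered by the open balls $B(z_i,r_i)$, and $r_i\le R$ and $\|z_i\|-r_i>\delta$ for all $i$. A Schauder basis $(e_n)_{n\in\mathbb{N}}$ is unconditional if there is a constant $C\ge 1$ such that $\|\sum a_ne_n\|\le C\|\sum b_ne_n\|$ for all scalar sequences $(a_n),(b_n)$ with $|a_n|\le|b_n|$ for all $n$ (for which the series converge); the best such $C$ is called its unconditional constant. The basis is shrinking if the closed linear span of its biorthogonal functionals $(e_n^* )$ is the whole dual space $X^*$. *)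

(* Defs.v *)
From HB Require Import structures.
From mathcomp Require Import all_boot all_order all_algebra.
From mathcomp Require Import complex.
From mathcomp Require Import all_classical all_reals.
From mathcomp Require Import topology normedtype sequences.

Set Implicit Arguments.
Unset Strict Implicit.
Unset Printing Implicit Defensive.

Import Order.TTheory GRing.Theory Num.Theory.
Import numFieldNormedType.Exports.

Local Open Scope classical_set_scope.
Local Open Scope ring_scope.

Variant real_or_complex (R : realType) : numFieldType -> Prop :=
| RealScalars : real_or_complex R R
| ComplexScalars : real_or_complex R R[i].

(* Norms of a [normedModType K] take their values in [K], also for [K = R[i]],
   where [x <= y] means that [y - x] is a nonnegative real; in particular
   bounds, radii and suprema of sets of norms are real elements of [K]. *)
Lemma scalar_isLub (R : realType) (K : numFieldType) (hK : real_or_complex R K)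
    (A : set K) :
  A !=set0 -> (forall x, A x -> 0 <= x) -> has_ubound A -> isLub A (supremum 0 A).
Proof.
move=> A0 Age0 Aub.
suff [m [ubm lbm]] : exists m, isLub A m.
  have : supremums A (supremum 0 A).
    rewrite /supremum; case: ifPn => [/eqP Ae|_].
      by case: A0 => x; rewrite Ae.
    by apply: (@xgetI _ _ _ m); split.
  by [].
case: hK A A0 Age0 Aub => A A0 Age0 Aub.
  exists (sup A); split; last by move=> b ub; apply: ge_sup.
  by apply: sup_upper_bound; split.
have ReA x : A x -> x = ((complex.Re x)%:C)%C.
  move=> Ax; have := Age0 _ Ax; case: (x) => a b.
  by rewrite lecE /= => /andP[/eqP -> _].
have Re_le (x y : R[i]) : x <= y -> complex.Re x <= complex.Re y.
  by case: x y => [a b] [c d]; rewrite lecE /= => /andP[].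
pose B : set R := [set complex.Re x | x in A].
have B0 : B !=set0 by case: A0 => x Ax; exists (complex.Re x); exists x.
have Bub : has_ubound B.
  by case: Aub => u ub; exists (complex.Re u) => _ [x Ax <-]; exact/Re_le/ub.
exists ((sup B)%:C)%C; split.
  move=> x Ax; rewrite (ReA _ Ax) lecR; apply: sup_upper_bound => //.
  by exists x.
move=> b ub; have [x0 Ax0] := A0.
have bE : b = ((complex.Re b)%:C)%C.
  have : 0 <= b by apply: le_trans (Age0 _ Ax0) (ub _ Ax0).
  by case: (b) => c d; rewrite lecE /= => /andP[/eqP -> _].
rewrite bE lecR; apply: ge_sup => // _ [x Ax <-]; exact/Re_le/ub.
Qed.

Section BoundedOperators.
Context (R : realType) (K : numFieldType) (hK : real_or_complex R K).
Context (X Y : normedModType K).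

Definition is_bounded_op : {pred X -> Y} :=
  fun f => `[< linear f /\ exists M : K, forall x, `|f x| <= M * `|x| >].

Lemma is_bounded_op_submod : submod_closed is_bounded_op.
Proof.
split => [|a f g].
  apply/asboolP; split => [c x y|]; first by rewrite /= scaler0 addr0.
  by exists 0 => x; rewrite normr0 mul0r.
move=> /asboolP[lf [M Mf]] /asboolP[lg [N Ng]]; apply/asboolP; split.
  move=> c x y; rewrite [LHS](_ : _ = a *: f (c *: x + y) + g (c *: x + y)) //.
  rewrite lf lg [in RHS](_ : (a *: f + g) = fun z => a *: f z + g z) //.
  by rewrite !scalerDr !scalerA (mulrC a c) addrACA.
exists (`|a| * M + N) => x; rewrite mulrDl -mulrA.
apply: le_trans (ler_normD _ _) _; apply: lerD; last exact: Ng.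
by rewrite normrZ; apply: ler_wpM2l.
Qed.

HB.instance Definition _ :=
  GRing.isSubmodClosed.Build K (X -> Y) is_bounded_op is_bounded_op_submod.

(* [hK] is a parameter only because the operator norm is a norm thanks to the
   completeness of the scalars. *)
Definition bounded_op (_ : real_or_complex R K) : Type :=
  {f : X -> Y | is_bounded_op f}.

Local Notation B := (bounded_op hK).

HB.instance Definition _ := SubType.on B.
HB.instance Definition _ := [Choice of B by <:].
HB.instance Definition _ := [SubChoice_isSubLmodule of B by <:].

Definition bounded_op_fun (f : B) : X -> Y := val f.
Coercion bounded_op_fun : bounded_op >-> Funclass.

Lemma bounded_op_linear (f : B) : linear f.
Proof. by have /asboolP[] := valP f. Qed.

HB.instance Definition _ (f : B) :=
  GRing.isLinear.Build K X Y _ f (bounded_op_linear f).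

Lemma bounded_op_bounded (f : B) : exists M : K, forall x, `|f x| <= M * `|x|.
Proof. by have /asboolP[] := valP f. Qed.

Definition opnorm (f : B) : K := supremum 0 [set `|f x| | x in [set x | `|x| <= 1]].

Lemma opnorm_isLub (f : B) :
  isLub [set `|f x| | x in [set x | `|x| <= 1]] (opnorm f).
Proof.
apply: (scalar_isLub hK).
- by exists `|f 0|; exists 0 => //=; rewrite normr0.
- by move=> _ [x _ <-].
have [M Mf] := bounded_op_bounded f; exists `|M| => _ [x /= x1 <-].
have M0 : 0 <= M * `|x| by exact: le_trans (Mf x).
apply: le_trans (Mf x) _; rewrite -(ger0_norm M0) normrM normr_id.
by rewrite -[leRHS]mulr1 ler_wpM2l.
Qed.

Lemma opnorm_ge0 (f : B) : 0 <= opnorm f.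
Proof.
have [ub _] := opnorm_isLub f; apply: le_trans (ub `|f 0| _) => //.
by exists 0 => //=; rewrite normr0.
Qed.

Lemma ler_opnorm (f : B) x : `|f x| <= opnorm f * `|x|.
Proof.
have [->|x0] := eqVneq x 0; first by rewrite linear0 !normr0 mulr0.
have nx : 0 < `|x| by rewrite normr_gt0.
rewrite -ler_pdivrMr // mulrC.
have [ub _] := opnorm_isLub f; apply: ub; exists (`|x|^-1 *: x).
  by rewrite /= normrZ normfV normr_id mulVf // gt_eqF.
by rewrite linearZ normrZ normfV normr_id.
Qed.

Lemma opnorm_le (f : B) (M : K) :
  (forall x, `|x| <= 1 -> `|f x| <= M) -> opnorm f <= M.
Proof. by move=> fM; have [_] := opnorm_isLub f; apply => _ [x x1 <-]; apply: fM. Qed.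

Lemma ler_opnormD (f g : B) : opnorm (f + g) <= opnorm f + opnorm g.
Proof.
apply: opnorm_le => x x1; apply: le_trans (ler_normD _ _) _.
by apply: lerD; apply: le_trans (ler_opnorm _ _) _;
  rewrite -[leRHS]mulr1; apply: ler_wpM2l => //; exact: opnorm_ge0.
Qed.

Lemma opnormZ_le (a : K) (f : B) : opnorm (a *: f) <= `|a| * opnorm f.
Proof.
apply: opnorm_le => x x1; rewrite [X in `|X|](_ : _ = a *: f x) // normrZ.
apply: ler_wpM2l => //; apply: le_trans (ler_opnorm _ _) _.
by rewrite -[leRHS]mulr1; apply: ler_wpM2l => //; exact: opnorm_ge0.
Qed.

Lemma opnorm0_eq0 (f : B) : opnorm f = 0 -> f = 0.
Proof.
move=> f0; apply/val_inj/funext => x; apply/eqP; rewrite -normr_le0.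
by have := ler_opnorm f x; rewrite f0 mul0r.
Qed.

Lemma opnormZ (a : K) (f : B) : opnorm (a *: f) = `|a| * opnorm f.
Proof.
apply/le_anti; rewrite opnormZ_le /=.
have [->|a0] := eqVneq a 0; first by rewrite normr0 mul0r opnorm_ge0.
rewrite -ler_pdivlMl ?normr_gt0 // -normfV.
by rewrite -[X in opnorm X <= _](scalerK a0); exact: opnormZ_le.
Qed.

HB.instance Definition _ :=
  @Lmodule_isNormed.Build K B opnorm ler_opnormD opnormZ opnorm0_eq0.

End BoundedOperators.

Arguments bounded_op {R K} X Y hK.
Arguments is_bounded_op {K} X Y.

(* B(X) *)
Definition endomorphisms (R : realType) (K : numFieldType)
    (hK : real_or_complex R K) (X : normedModType K) : normedModType K :=
  bounded_op X X hK.

(* X^* *)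
Definition dual (R : realType) (K : numFieldType)
    (hK : real_or_complex R K) (X : normedModType K) : normedModType K :=
  bounded_op X K^o hK.

Definition UBCP (K : numFieldType) (Z : normedModType K) : Prop :=
  exists (z : nat -> Z) (r : nat -> K) (rho delta : K),
    [/\ 0 < rho, 0 < delta, forall i, 0 < r i,
        [set x : Z | `|x| = 1] `<=` \bigcup_i ball (z i) (r i) &
        forall i, r i <= rho /\ delta < `|z i| - r i].

Section Bases.
Context (K : numFieldType) (X : normedModType K).
Implicit Types (e : nat -> X) (a b : nat -> K).

Definition expansion e a (x : X) : Prop :=
  series (fun n => a n *: e n) @ \oo --> x.

Definition schauder_basis e : Prop := forall x, exists! a, expansion e a x.

Definition unconditionality_bounds e : set K :=
  [set C | 1 <= C /\
    forall a b x y, (forall n, `|a n| <= `|b n|) ->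
      expansion e a x -> expansion e b y -> `|x| <= C * `|y| ].

Definition unconditional_basis e : Prop :=
  schauder_basis e /\ unconditionality_bounds e !=set0.

Definition unconditional_constant e : K := infimum 0 (unconditionality_bounds e).

End Bases.

Definition linear_span (K : numFieldType) (V : lmodType K) (v : nat -> V) :
    set V :=
  [set w | exists (n : nat) (a : nat -> K), w = \sum_(i < n) a i *: v i].

(* A continuous functional is determined by its values on a Schauder basis, so
   [es] below can only be the sequence of coordinate functionals. *)
Definition shrinking (R : realType) (K : numFieldType)
    (hK : real_or_complex R K) (X : normedModType K) (e : nat -> X) : Prop :=
  exists2 es : nat -> dual hK X,
    (forall m n, (es m : bounded_op X K^o hK) (e n) = (m == n)%:R) &
    closure (linear_span es) = [set: dual hK X].

(* Main.v *)
Require Import Defs.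
From mathcomp Require Import all_boot all_order all_algebra.
From mathcomp Require Import ring complex.
From mathcomp Require Import all_classical all_reals.
From mathcomp Require Import topology normedtype sequences.

(** For an operator [T] of norm 1 and the basis projections [P n], changing the
    signs of the first [n] coordinates gives [`|T - 2 P n T| <= C] with [C < 2],
    whereas [`|2 P n T|] is arbitrarily close to 2 for suitable [n]. The operator
    [P n T] is the sum of the [e k (x) (e*_k o T)] for [k < n], and as the basis is
    shrinking each functional [e*_k o T] is a norm limit of combinations of
    coordinate functionals with rational coefficients. Hence countably many
    centres, with one common radius, suffice. *)

Set Implicit Arguments.
Unset Strict Implicit.
Unset Printing Implicit Defensive.

Import Order.TTheory GRing.Theory Num.Theory.
Import numFieldNormedType.Exports.

Local Open Scope classical_set_scope.
Local Open Scope ring_scope.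

(** * Scalars: a countable dense family, and the infimum defining the unconditional constant *)

Lemma rational_scalars_dense (R : realType) (K : numFieldType)
    (hK : real_or_complex R K) :
  exists q : rat * rat -> K,
    forall c eps, 0 < eps -> exists i, `|c - q i| < eps.
Proof.
have ratP (x eps : R) : 0 < eps -> exists r : rat, `|x - ratr r| < eps.
  move=> eps0; have [|r] := @rat_in_itvoo R (x - eps) (x + eps).
    by rewrite ltrD2l gtrN.
  rewrite in_itv /= => /andP[h1 h2]; exists r.
  by rewrite distrC ltr_distl h1 h2.
case: hK.
  exists (fun i => ratr i.1) => c eps /(ratP c)[r cr]; exists (r, 0); exact: cr.
exists (fun i => (ratr i.1 +i* ratr i.2)%C) => -[a b] [eps im].
(* A positive [eps] in [R[i]] is real; each coordinate gets half of it. *)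
rewrite ltcE /= => /andP[/eqP -> eps0].
have eps20 : 0 < eps / 2 by rewrite divr_gt0.
have [r ar] := ratP a _ eps20; have [s bs] := ratP b _ eps20.
have normcR (x : R) : `|x%:C%C| = `|x|%:C%C.
  by rewrite normc_def /= expr0n addr0 sqrtr_sqr.
exists (r, s) => /=; rewrite [X in `|X|](_ : _ =
  (a - ratr r)%:C%C + 'i%C * (b - ratr s)%:C%C); last first.
  by rewrite [LHS]complexE.
apply: le_lt_trans (ler_normD _ _) _.
rewrite normrM [`|'i%C|](_ : _ = 1); last first.
  by rewrite normc_def /= expr0n expr1n add0r sqrtr1.
by rewrite mul1r !normcR -raddfD ltcR [eps]splitr ltrD.
Qed.

(** If no bound were below 2, then 2 would be a lower bound, hence at most the infimum. As the order
    of [K] may be partial, the existence of the infimum is derived from [scalar_isLub], as a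
    supremum of lower bounds. *)
Lemma unconditionality_bound_lt2 (R : realType) (K : numFieldType)
    (hK : real_or_complex R K) (X : normedModType K) (e : nat -> X) :
  unconditional_basis e -> unconditional_constant e < 2 ->
  exists2 C, unconditionality_bounds e C & C < 2.
Proof.
move=> [_ [C0 C0b]] ltc2.
set A := unconditionality_bounds e.
have A_real C : A C -> C \is Num.real.
  by case=> C1 _; apply: ger0_real; apply: le_trans C1.
have [//|noC] := pselect (exists2 C, A C & C < 2).
have ge2 C : A C -> 2 <= C.
  move=> AC; have [//|ltC2] := real_leP (ger0_real (ler0n K 2)) (A_real _ AC).
  by case: noC; exists C.
(* [scalar_isLub] wants nonnegative elements; negative lower bounds are compared through [1], which
   lies in [B]. *)
pose B : set K := [set b | 0 <= b /\ lbound A b].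
have B1 : B 1 by split => // C [].
have [ubB lubB] : isLub B (supremum 0 B).
  apply: (scalar_isLub hK); first by exists 1.
    by move=> x [].
  by exists C0 => b [_]; apply.
have infA : infimums A (supremum 0 B).
  split; first by move=> C AC; apply: lubB => b [_]; apply.
  move=> b lbb.
  have b_real : b \is Num.real.
    by rewrite (ler_real (lbb _ C0b)) A_real.
  have [b0|b0] := real_leP (ger0_real (lexx 0)) b_real; first exact: ubB.
  by apply: le_trans (ltW b0) _; apply: le_trans ler01 _; exact: ubB.
(* The default value 0 of [infimum] is excluded, since [C0] belongs to [A]. *)
have [_ /(_ 2) glb] : infimums A (unconditional_constant e).
  rewrite /unconditional_constant /infimum; case: ifPn => [/eqP AE|_].
    by move: C0b; rewrite /A AE.
  exact: (xgetI _ infA).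
by have := lt_le_trans ltc2 (glb (fun C AC => ge2 C AC)); rewrite ltxx.
Qed.

(** * Compositions, rank-one operators and almost norming vectors *)

Section BoundedOperatorConstructions.
Context (R : realType) (K : numFieldType) (hK : real_or_complex R K).

Lemma comp_bounded (X Y Z : normedModType K) (g : bounded_op Y Z hK)
  (f : bounded_op X Y hK) : is_bounded_op X Z (fun x => g (f x)).
Proof.
apply/asboolP; split => [a x y|]; first by rewrite !linearP.
exists (opnorm g * opnorm f) => x; apply: le_trans (ler_opnorm _ _) _.
by rewrite -mulrA ler_wpM2l ?opnorm_ge0 // ler_opnorm.
Qed.

Definition comp_op (X Y Z : normedModType K) (g : bounded_op Y Z hK)
  (f : bounded_op X Y hK) : bounded_op X Z hK :=
  exist _ (fun x => g (f x)) (comp_bounded g f).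

Lemma rank_one_bounded (X Y : normedModType K) (y : Y)
  (f : bounded_op X K^o hK) : is_bounded_op X Y (fun x => (f x : K) *: y).
Proof.
apply/asboolP; split => [a u v|].
  by rewrite linearP scalerDl scalerA.
exists (opnorm f * `|y|) => x; rewrite normrZ mulrAC ler_wpM2r //.
exact: ler_opnorm.
Qed.

Definition rank_one (X Y : normedModType K) (y : Y) (f : bounded_op X K^o hK) :
  bounded_op X Y hK := exist _ (fun x => (f x : K) *: y) (rank_one_bounded y f).

Lemma rank_oneE (X Y : normedModType K) (y : Y) (f : bounded_op X K^o hK) x :
  rank_one y f x = (f x : K) *: y.
Proof. by []. Qed.

Lemma rank_oneB (X Y : normedModType K) (y : Y) (f g : bounded_op X K^o hK) :
  rank_one y (f - g) = rank_one y f - rank_one y g.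
Proof.
apply/val_inj/funext => x.
by rewrite /= [LHS](_ : _ = (f x - g x : K) *: y) // scalerBl.
Qed.

Lemma norm_rank_one_le (X Y : normedModType K) (y : Y)
  (f : bounded_op X K^o hK) : `|rank_one y f| <= `|f| * `|y|.
Proof.
apply: opnorm_le => x x1; rewrite /= normrZ ler_wpM2r //.
apply: le_trans (ler_opnorm f x) _; rewrite -[leRHS]mulr1.
by rewrite ler_wpM2l // opnorm_ge0.
Qed.

Lemma sum_opE (X Y : normedModType K) (n : nat) (F : nat -> bounded_op X Y hK)
  (x : X) : (\sum_(k < n) F k : bounded_op X Y hK) x = \sum_(k < n) F k x.
Proof. by apply: (big_morph (fun f : bounded_op X Y hK => f x)). Qed.

Lemma norm1_almost_attained (X Y : normedModType K) (T : bounded_op X Y hK)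
  (eps : K) : `|T| = 1 -> 0 < eps ->
  exists2 x, `|x| <= 1 & 1 - eps < `|T x|.
Proof.
move=> T1 eps0; have [//|nox] := pselect (exists2 x, `|x| <= 1 & 1 - eps < `|T x|).
have r_real : 1 - eps \is Num.real by rewrite rpredB ?rpred1 ?gtr0_real.
have : `|T| <= 1 - eps.
  apply: opnorm_le => x x1.
  have [//|h] := real_leP (normr_real (T x)) r_real.
  by case: nox; exists x.
by rewrite T1 lerDl oppr_ge0 => /(lt_le_trans eps0); rewrite ltxx.
Qed.

End BoundedOperatorConstructions.


(** * Countable approximation and countable covers *)

Lemma mul_lt_of_lt_div (K : numFieldType) (m t eps : K) :
  0 <= m -> 0 <= t -> t < eps / (m + 1) -> t * m < eps.
Proof.
(* The added 1 keeps the denominator positive when [m = 0]. *)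
move=> m0 t0; have m10 : 0 < m + 1 by rewrite ltr_wpDl.
rewrite ltr_pdivlMr // => tm; apply: le_lt_trans tm.
by rewrite ler_wpM2l // lerDl.
Qed.

(** A list over [I] records both the number of terms and the choice made for each, so a countable
    [I] yields countably many approximants. *)
Lemma approx_sum (K : numFieldType) (V : normedModType K) (I : Type) (i0 : I)
  (F : nat -> V) (D : nat -> I -> V) :
  (forall k eps, 0 < eps -> exists i, `|F k - D k i| < eps) ->
  forall n eps, 0 < eps -> exists s : seq I,
    `|\sum_(k < n) F k - \sum_(k < size s) D k (nth i0 s k)| < eps.
Proof.
move=> FD n eps eps0.
suff [s [_]] : exists s : seq I, size s = n /\
    `|\sum_(k < n) F k - \sum_(k < size s) D k (nth i0 s k)| < eps.
  by exists s.
elim: n eps eps0 => [|n IH] eps eps0.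
  by exists [::]; rewrite !big_ord0 subrr normr0.
have eps20 : 0 < eps / 2 by rewrite divr_gt0.
have [s [sn]] := IH _ eps20; rewrite sn => hs; have [i hi] := FD n _ eps20.
exists (rcons s i); split; first by rewrite size_rcons sn.
rewrite size_rcons !big_ord_recr /= nth_rcons ltnn eqxx sn.
under [X in _ - (X + _)]eq_bigr => k _ do rewrite nth_rcons sn ltn_ord.
rewrite opprD addrACA [eps]splitr; apply: le_lt_trans (ler_normD _ _) _.
exact: ltrD.
Qed.

(** Half of [eps] pays for replacing [w] by a point of the span, half for rounding its
    coefficients. *)
Lemma closure_span_dense (R : realType) (K : numFieldType)
    (hK : real_or_complex R K) (V : normedModType K) (v : nat -> V) :
  exists d : seq (rat * rat) -> V, forall w eps,
    closure (linear_span v) w -> 0 < eps -> exists s, `|w - d s| < eps.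
Proof.
have [q qP] := rational_scalars_dense hK.
exists (fun s => \sum_(k < size s) q (nth (0, 0) s k) *: v k) => w eps clw eps0.
have eps20 : 0 < eps / 2 by rewrite divr_gt0.
have [_ [[n [a ->]] wa]] := clw _ (nbhsx_ballx w _ eps20).
have [|s hs] := @approx_sum K V _ (0, 0) (fun k => a k *: v k)
    (fun k i => q i *: v k) _ n _ eps20.
  move=> k r r0.
  have [|i hi] := qP (a k) (r / (`|v k| + 1)).
    by rewrite divr_gt0 // ltr_wpDl.
  by exists i; rewrite -scalerBl normrZ; apply: mul_lt_of_lt_div.
exists s; rewrite -(subrKA (\sum_(i < n) a i *: v i)) [eps]splitr.
apply: le_lt_trans (ler_normD _ _) _; rewrite ltrD //.
by move: wa; rewrite -ball_normE.
Qed.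

(** [UBCP] constrains every ball, whereas the cover vouches only for the balls in use. Indices that
    violate the margin, and numbers coding no index, are redirected to an index [i0] serving the
    unit vector [x0]. *)
Lemma UBCP_of_countable_cover (K : numFieldType) (Z : normedModType K)
    (I : countType) (z : I -> Z) (r delta : K) (x0 : Z) :
  0 < r -> 0 < delta -> `|x0| = 1 ->
  (forall x, `|x| = 1 -> exists i, `|x - z i| < r /\ delta < `|z i| - r) ->
  UBCP Z.
Proof.
move=> r0 delta0 x01 cover; have [i0 [_ i0P]] := cover _ x01.
pose c n := if unpickle n is Some i
  then if delta < `|z i| - r then i else i0 else i0.
have cP n : delta < `|z (c n)| - r.
  by rewrite /c; case: unpickle => // i; case: ifP.
exists (fun n => z (c n)), (fun=> r), r, delta; split => // x /= x1.
have [i [xi iP]] := cover _ x1; exists (pickle i) => //.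
by rewrite -ball_normE /= /c pickleK iP distrC.
Qed.

(** * Basis projections and sign changes *)

Section BasisProjections.
Context (R : realType) (K : numFieldType) (hK : real_or_complex R K).
Context (X : normedModType K) (e : nat -> X) (es : nat -> bounded_op X K^o hK).
Hypothesis es_e : forall m n, es m (e n) = (m == n)%:R.

(** On every partial sum that includes the term [k], the functional [es k] equals [a k]; its error
    at [x] is thus at most [opnorm (es k)] times the norm of a tail, which tends to 0. *)
Lemma coordinate_expansion (a : nat -> K) (x : X) (k : nat) :
  expansion e a x -> es k x = a k.
Proof.
move=> ax; apply/eqP; rewrite -subr_eq0 -normr_eq0; apply/negPn/negP => d0.
have {}d0 : 0 < `|es k x - a k| by rewrite lt_def d0 normr_ge0.
have eps0 : 0 < `|es k x - a k| / (opnorm (es k) + 1).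
  by rewrite divr_gt0 // ltr_wpDl // opnorm_ge0.
have [N _ NP] := cvgr_dist_lt _ _ ax _ eps0.
have := NP (maxn N k.+1) (leq_maxl _ _).
move=> /(mul_lt_of_lt_div (opnorm_ge0 _) (normr_ge0 _)).
suff -> : es k x - a k = es k (x - series (fun n => a n *: e n) (maxn N k.+1)).
  by rewrite mulrC => /(le_lt_trans (ler_opnorm _ _)); rewrite ltxx.
rewrite linearB; congr (_ - _).
rewrite /series /= big_mkord linear_sum.
have kM : (k < maxn N k.+1)%N by rewrite leq_max ltnSn orbT.
rewrite (bigD1 (Ordinal kM)) //= linearZ /= es_e eqxx.
rewrite big1 => [|i ik]; first by rewrite addr0; exact: esym (mulr1 _).
rewrite linearZ /= es_e; case: eqP => [ki|_]; last exact: mulr0.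
by case/eqP: ik; apply: val_inj.
Qed.

(** The rank-one form gives boundedness by construction; [basis_projE] identifies it with the
    partial sum map. *)
Definition basis_proj (n : nat) : bounded_op X X hK :=
  \sum_(k < n) rank_one (e k) (es k).

Lemma basis_projE (a : nat -> K) (x : X) (n : nat) :
  expansion e a x -> basis_proj n x = series (fun k => a k *: e k) n.
Proof.
move=> ax; rewrite /series /= big_mkord /basis_proj.
rewrite (sum_opE _ (fun k => rank_one (e k) (es k))).
by apply: eq_bigr => k _; rewrite rank_oneE (coordinate_expansion k ax).
Qed.

(** From [n] on, the sign change shifts all partial sums by the same vector, twice the [n]-th
    partial sum, so it shifts the limit likewise. *)
Lemma expansion_sign_change (a : nat -> K) (x : X) (n : nat) :
  expansion e a x ->
  expansion e (fun k => if (k < n)%N then - a k else a k)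
    (x - basis_proj n x *+ 2).
Proof.
move=> ax; rewrite /expansion (basis_projE n ax).
apply/cvgrPdist_lt => eps eps0.
have [N _ NP] := cvgr_dist_lt _ _ ax _ eps0.
exists (maxn N n) => // m /=; rewrite geq_max => /andP[Nm nm].
set b := fun k => if (k < n)%N then - a k else a k.
suff SE : series (fun k => a k *: e k) m =
    series (fun k => a k *: e k) n *+ 2 + series (fun k => b k *: e k) m.
  by have := NP m Nm; rewrite /= SE opprD addrA.
rewrite /series /= !(big_cat_nat (leq0n n) nm) //= addrA; congr (_ + _); last first.
  by apply: eq_big_nat => k /andP[nk _]; rewrite /b ltnNge nk.
rewrite [X in _ + X](_ : _ = - \sum_(0 <= k < n) a k *: e k).
  by rewrite mulr2n addrK.
rewrite -sumrN; apply: eq_big_nat => k /andP[_ kn]; rewrite /b kn.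
by rewrite scaleNr.
Qed.

Lemma norm_sign_change_le (C : K) (T : bounded_op X X hK) (n : nat) :
  schauder_basis e -> unconditionality_bounds e C ->
  `|T - comp_op (basis_proj n) T *+ 2| <= C * `|T|.
Proof.
move=> basis [C1 CP]; apply: opnorm_le => x x1.
rewrite [X in `|X|](_ : _ = T x - basis_proj n (T x) *+ 2) //.
have [a [ax _]] := basis (T x).
apply: (@le_trans _ _ (C * `|T x|)).
  apply: (CP _ a _ _ _ (expansion_sign_change ax) ax) => k.
  by case: ifP => // _; rewrite normrN.
rewrite ler_wpM2l // ?(le_trans ler01) //.
apply: le_trans (ler_opnorm T x) _; rewrite -[leRHS]mulr1.
by rewrite ler_wpM2l // opnorm_ge0.
Qed.

(** Half of [eps] goes to an almost norming vector [x], half to truncating the expansion of [T x];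
    thus [n] depends on [T]. *)
Lemma norm_proj_comp_gt (T : bounded_op X X hK) (eps : K) :
  schauder_basis e -> `|T| = 1 -> 0 < eps ->
  exists n, 1 - eps < `|comp_op (basis_proj n) T|.
Proof.
move=> basis T1 eps0; have eps20 : 0 < eps / 2 by rewrite divr_gt0.
have [x x1 Tx] := norm1_almost_attained T1 eps20.
have [a [ax _]] := basis (T x).
have [n _ /(_ n (leqnn n))] := cvgr_dist_lt _ _ ax _ eps20.
rewrite /= -(basis_projE n ax) => Pn; exists n.
apply: (@lt_le_trans _ _ `|basis_proj n (T x)|); last first.
  apply: le_trans (ler_opnorm (comp_op (basis_proj n) T) x) _.
  by rewrite -[leRHS]mulr1 ler_wpM2l // opnorm_ge0.
rewrite -(ltrD2r (eps / 2)).
apply: (@lt_le_trans _ _ (`|T x|)).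
  by rewrite [X in 1 - X]splitr opprD addrA subrK.
rewrite -lerBlDl; apply: le_trans (ltW Pn).
exact: lerB_dist.
Qed.

(** The vectors [e k] stay exact: only the functionals [es k] composed with [T] depend on [T], and
    each is coded by one entry of [t]. *)
Lemma proj_comp_dense (d : seq (rat * rat) -> dual hK X) :
  (forall (f : dual hK X) eps, 0 < eps -> exists s, `|f - d s| < eps) ->
  forall (T : bounded_op X X hK) n eps, 0 < eps ->
  exists t, `|comp_op (basis_proj n) T -
    \sum_(k < size t) rank_one (e k) (d (nth [::] t k))| < eps.
Proof.
move=> dP T n eps eps0.
rewrite [comp_op _ _](_ : _ =
    \sum_(k < n) rank_one (e k) (comp_op (es k) T)); last first.
  apply/val_inj/funext => x.
  rewrite [RHS](sum_opE _ (fun k => rank_one (e k) (comp_op (es k) T))).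
  exact: (sum_opE _ (fun k => rank_one (e k) (es k))).
apply: (@approx_sum K (bounded_op X X hK) _ [::]
  (fun k => rank_one (e k) (comp_op (es k) T))
  (fun k s => rank_one (e k) (d s))) => // k r r0.
have [|s hs] := dP (comp_op (es k) T) (r / (`|e k| + 1)).
  by rewrite divr_gt0 // ltr_wpDl.
exists s; rewrite -rank_oneB; apply: le_lt_trans (norm_rank_one_le _ _) _.
exact: mul_lt_of_lt_div.
Qed.

End BasisProjections.

(** * Covering the unit sphere of the operator space *)

Theorem corollary3p2 (R : realType) (K : numFieldType)
    (hK : real_or_complex R K) (X : completeNormedModType K) (e : nat -> X)
    (e_unconditional : unconditional_basis e)
    (e_constant : unconditional_constant e < 2)
    (e_shrinking : shrinking hK e) :
  UBCP (endomorphisms hK X).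
Proof.
have [C Cb C2] := unconditionality_bound_lt2 hK e_unconditional e_constant.
have [basis _] := e_unconditional.
have [es es_e es_dense] := e_shrinking.
have [d dP] := closure_span_dense hK es.
have {}dP (f : dual hK X) eps : 0 < eps -> exists s, `|f - d s| < eps.
  by apply: dP; rewrite es_dense.
have [C1 _] := Cb.
(* The centres used have norm above [2 - 3 eta], while radius plus margin is
   [C + 2 eta = 2 - 6 eta]; a slack of [3 eta] remains. *)
pose eta := (2 - C) / 8.
have eta0 : 0 < eta by rewrite divr_gt0 // subr_gt0.
have CE : C = 2 - eta * 8 by rewrite /eta divfK ?pnatr_eq0 // subKr.
pose z (t : seq (seq (rat * rat))) : endomorphisms hK X :=
  (\sum_(k < size t) rank_one (e k) (d (nth [::] t k))) *+ 2.
(* Normalised, [N] is the unit vector that the covering lemma asks for; it is nonzero because it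
   fixes [e 0], which is nonzero. *)
pose N : endomorphisms hK X := rank_one (e 0) (es 0).
have N0 : N != 0.
  apply/eqP => NE; have := rank_oneE (e 0) (es 0) (e 0).
  rewrite -/N NE es_e scale1r => e0.
  have := es_e 0 0; rewrite -e0 linear0 => /esym/eqP.
  by rewrite oner_eq0.
have N1 : `| `|N|^-1 *: N| = 1.
  by rewrite normrZ normfV normr_id mulVf // normr_eq0.
apply: (@UBCP_of_countable_cover K _ _ z (C + eta) eta _ _ eta0 N1).
  by rewrite ltr_wpDl // (le_trans ler01).
move=> T T1; have [n Tn] := norm_proj_comp_gt es_e basis T1 eta0.
(* The tolerance is halved because [z t] doubles the approximant. *)
have [t tP] := proj_comp_dense e es dP T n (divr_gt0 eta0 (ltr0n K 2)).
exists t.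
set P := comp_op (basis_proj e es n) T in Tn tP.
have Pz : `|P *+ 2 - z t| < eta.
  by rewrite /z -mulrnBl normrMn mulr2n [eta]splitr ltrD.
split.
  (* Passing through [P *+ 2] costs [C] by the sign change and less than [eta] by the
     approximation. *)
  rewrite -(subrKA (P *+ 2)); apply: le_lt_trans (ler_normD _ _) _.
  apply: ler_ltD Pz; rewrite -[C]mulr1 -T1.
  exact: norm_sign_change_le.
rewrite ltrBrDr -(ltrD2r eta).
apply: (@lt_trans _ _ (`|P *+ 2|)).
  apply: (@lt_trans _ _ ((1 - eta) *+ 2)); last first.
    by rewrite normrMn !mulr2n ltrD.
  rewrite CE -subr_gt0 [ltRHS](_ : _ = eta *+ 3); first by rewrite pmulrn_lgt0.
  by ring.
rewrite -ltrBlDl; apply: le_lt_trans Pz.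
exact: lerB_dist.
Qed.
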